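(* Let $N\subseteq\mathcal{A}\subseteq\mathbb{R}^{d_\alpha}$ be open and let $r\in L_2(\eta_0)$, $\phi(\eta_0)=\mathbb{E}_{\eta_0}[r(\alpha)]$. Suppose there exists $s\in L_2^0(\mathbb{P})$ such that $$r(\alpha)-\phi(\eta_0)=\int s(z)f_{z/\alpha}(z)\,d\mu(z). \qquad (\ast)$$ Assume further that: (i) $\alpha\mapsto f_{z/\alpha}(z)$ is continuous on $N$ for $\mu$-a.e. $z$; (ii) for every $\alpha\in N$ there exists a neighborhood $\Gamma_0\subset N$ of $\alpha$ such that for all $s$ satisfying $(\ast)$, $$\int |s(z)|\sup_{\alpha\in\Gamma_0}f_{z/\alpha}(z)\,d\mu(z)<\infty .$$ Then $r$ is continuous in $\alpha$ on $N$.
   Context: Setting: $(Z,\alpha)$ is a random element; $Z$ is observed and $\alpha$ (unobserved heterogeneity, UH) is not. $\alpha$ has distribution $\eta_0$ with support $\mathcal{A}\subseteq\mathbb{R}^{d_\alpha}$. $Z$ has law $\mathbb{P}$ with density, with respect to a $\sigma$-finite measure $\mu$, $f_{\eta_0}(z)=\int_{\mathcal{A}}f_{z/\alpha}(z)\,d\eta_0(\alpha)$, where $f_{z/\alpha}$ is the known conditional density of $Z$ given $\alpha$. $L_2(\nu)$ is the space of equivalence classes of real-valued $\nu$-square-integrable functions, and $L_2^0(\nu)$ its subspace of functions with zero $\nu$-mean. Convention: equalities between functions of $\alpha$ such as $(\ast)$ hold $\eta_0$-almost surely, and an element of $L_2(\eta_0)$ is called continuous on $N$ if its equivalence class contains a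 function continuous on $N$. *)

(* Defs.v *)
From HB Require Import structures.
From mathcomp Require Import all_boot all_order all_algebra.
From mathcomp Require Import all_classical all_reals all_analysis.

Set Implicit Arguments.
Unset Strict Implicit.
Unset Printing Implicit Defensive.

Import Order.TTheory GRing.Theory Num.Theory.
Import numFieldNormedType.Exports.

Local Open Scope classical_set_scope.
Local Open Scope ring_scope.

(* R^d with its usual topology and its Borel sigma-algebra. It is an alias of
   row vectors because the library puts no sigma-algebra on them. *)
Definition euclid (R : realType) (d : nat) : Type := 'rV[R]_d.

Section euclid_instances.
Variables (R : realType) (d : nat).

HB.instance Definition _ := NormedModule.on (euclid R d).
HB.instance Definition _ := Complete.on (euclid R d).

HB.instance Definition _ := @isMeasurable.Build
  (sigma_display (@open 'rV[R]_d)) (euclid R d)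
  <<s @open 'rV[R]_d >>
  (@sigma_algebra0 _ setT (@open 'rV[R]_d))
  (@sigma_algebraC _ (@open 'rV[R]_d))
  (@sigma_algebra_bigcup _ setT (@open 'rV[R]_d)).

End euclid_instances.

(* The topological support of a measure on R^d: its complement is the union of
   the open null sets. *)
Definition msupport (R : realType) (d : nat)
    (nu : {measure set (euclid R d) -> \bar R}) : set (euclid R d) :=
  [set a | forall U : set (euclid R d), open U -> U a -> (0 < nu U)%E].

(* (Z, alpha) is a random element defined on (Omega, Pr); eta0 is the law of
   alpha, with support A, and P is the law of Z. [f a z] is f_{z/a}(z), the
   density at z, with respect to mu, of Z given alpha = a; nothing is assumed
   of it when a is outside A. [uh_density] follows from [uh_cond_density] by
   Tonelli's theorem. *)
Record uh_model (R : realType) (d : nat)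
    (dO : measure_display) (Omega : measurableType dO) (Pr : probability Omega R)
    (dZ : measure_display) (ZT : measurableType dZ)
    (Z : {RV Pr >-> ZT}) (alpha : {RV Pr >-> euclid R d})
    (A : set (euclid R d)) (mu : {sigma_finite_measure set ZT -> \bar R})
    (f : euclid R d -> ZT -> R)
    (eta0 : probability (euclid R d) R) (P : probability ZT R) : Prop := {
  uh_law_alpha : forall C : set (euclid R d), measurable C ->
    eta0 C = distribution Pr alpha C ;
  uh_support : A = msupport eta0 ;
  uh_law_Z : forall B : set ZT, measurable B -> P B = distribution Pr Z B ;
  uh_f_ge0 : forall a z, A a -> 0 <= f a z ;
  uh_f_measurable :
    measurable_fun (A `*` [set: ZT]) (fun az : euclid R d * ZT => f az.1 az.2) ;
  uh_f_int1 : forall a, A a -> (\int[mu]_z (f a z)%:E = 1)%E ;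
  uh_cond_density : forall (B : set ZT) (C : set (euclid R d)),
    measurable B -> measurable C ->
    (Pr (Z @^-1` B `&` alpha @^-1` C) =
      \int[eta0]_(a in A `&` C) \int[mu]_(z in B) (f a z)%:E)%E ;
  uh_density : forall B : set ZT, measurable B ->
    (P B = \int[mu]_(z in B) \int[eta0]_(a in A) (f a z)%:E)%E
}.

(* Membership of an element of L_2(nu) in L_2^0(nu). *)
Definition L2_0 (R : realType) (dT : measure_display) (T : measurableType dT)
    (nu : probability T R) (s : LspaceType2 nu) : Prop :=
  ('E_nu[s] = 0)%E.

Definition phi (R : realType) (d : nat) (eta0 : probability (euclid R d) R)
    (r : LspaceType2 eta0) : R :=
  fine 'E_eta0[r].

(* An element of L_2 is applied through a representative of its class. The
   choice is immaterial here: P has a density with respect to mu, so for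
   eta0-almost every a in A a P-null set is null for f a z dmu(z).
   The Lebesgue integral is extended-real valued; equality with a real number
   entails that it converges. *)
Definition moment_eq (R : realType) (d : nat)
    (dZ : measure_display) (ZT : measurableType dZ)
    (mu : {sigma_finite_measure set ZT -> \bar R})
    (f : euclid R d -> ZT -> R)
    (eta0 : probability (euclid R d) R) (P : probability ZT R)
    (r : LspaceType2 eta0) (s : LspaceType2 P) : Prop :=
  {ae eta0, forall a,
    ((r a - phi r)%:E = \int[mu]_z (s z * f a z)%:E)%E}.

Definition L2_continuous_on (R : realType) (d : nat)
    (eta0 : probability (euclid R d) R) (N : set (euclid R d))
    (r : LspaceType2 eta0) : Prop :=
  exists g : {mfun euclid R d >-> R},
    (g = r %[ae eta0]) /\ {in N, continuous g}.

(* Main.v *)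
(* The continuous version of [r] is [phi r + \int s f_a dmu] on [N] and [r] off
   [N]. Continuity on [N] is dominated convergence along sequences [u n --> a]
   staying in [Gamma0]: the dominating function [|s| sup_n f_{u n}] is
   measurable, being a countable supremum, whereas [|s| sup_{b in Gamma0} f_b]
   need not be. *)

Require Import Defs.
From HB Require Import structures.
From mathcomp Require Import all_boot all_order all_algebra.
From mathcomp Require Import all_classical all_reals all_analysis.
From mathcomp Require Import measurable_realfun.

Import Order.TTheory GRing.Theory Num.Theory.
Import numFieldNormedType.Exports.

Local Open Scope classical_set_scope.
Local Open Scope ring_scope.

(** By contradiction: if the preimage of a neighbourhood [B] of [l] is not a neighbourhood of [p],
    then [U] meets every ball around [p] outside it, and a choice of such points is a sequence in
    [U] tending to [p] whose image never enters [B]. Testing only sequences inside [U] is what lets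
    a bound valid on [U] be used. *)
Lemma seq_cvg_at {R : realType} {V : pseudoMetricType R}
    {W : topologicalType} (f : V -> W) (p : V) (l : W) (U : set V) :
  nbhs p U ->
  (forall u : nat -> V, (forall n, U (u n)) -> u n @[n --> \oo] --> p ->
    f (u n) @[n --> \oo] --> l) ->
  f x @[x --> p] --> l.
Proof.
move=> pU seqf B lB; apply: contrapT => npB.
have /choice[u Hu] n : exists x, [/\ U x, ball p n.+1%:R^-1 x & ~ B (f x)].
  apply: contrapT => /forallNP h; apply: npB => /=.
  have pb : nbhs p (ball p (n.+1%:R^-1 : R)).
    by apply: nbhsx_ballx; rewrite invr_gt0.
  apply: (filterS _ (filterI pU pb)) => x [Ux bx].
  by apply: contrapT => nB; exact: (h x).
have up : u n @[n --> \oo] --> p.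
  apply/cvg_ballP => e e0; near=> n.
  have [_ + _] := Hu n; apply: le_ball; apply: ltW.
  by near: n; exact: near_infty_natSinv_lt (PosNum e0).
have Uu n : U (u n) by have [] := Hu n.
have [n _ /(_ n (leqnn _))] := seqf u Uu up B lB.
by have [] := Hu n.
Unshelve. all: by end_near. Qed.

(* True for nonmeasurable functions as well: the library's integral of a
   nonnegative function is the supremum over the simple functions below it. *)
Lemma ge0_integral_mono {d} {T : measurableType d} {R : realType}
    (mu : {measure set T -> \bar R}) (g h : T -> \bar R) :
  (forall x, 0 <= g x)%E -> (forall x, g x <= h x)%E ->
  (\int[mu]_x g x <= \int[mu]_x h x)%E.
Proof.
move=> g0 gh; rewrite !ge0_integralTE//; last first.
  by move=> x; exact: le_trans (gh x).
apply: ereal_sup_le => _ [k kg <-].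
by exists k => // x; exact: le_trans (gh x).
Qed.

Lemma open_euclid_measurable {R : realType} {d : nat} (U : set (euclid R d)) :
  open U -> measurable U.
Proof. exact: sub_sigma_algebra. Qed.

Lemma euclid_continuous_measurable {R : realType} {d : nat}
    (U : set (euclid R d)) (g : euclid R d -> R) :
  open U -> {in U, continuous g} -> measurable_fun U g.
Proof.
move=> oU cg; apply: (measurability _ (RGenOpens.measurableE R)).
move=> _ [_ [a [b ->] <-]]; apply: open_euclid_measurable.
(* The part of [U] that [g] sends into an open interval is open, since it is a neighbourhood of each
   of its points. *)
apply/interior_id/seteqP; split=> [|x [Ux gx]]; first exact: interior_subset.
apply: filterI; first exact: open_nbhs_nbhs.
by apply: (cg x (mem_set Ux)); apply: open_nbhs_nbhs; split.
Qed.

(** An open null set containing [a] excludes all of its points from the support, not only [a]. *)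
Lemma closed_msupport {R : realType} {d : nat}
    (nu : {measure set (euclid R d) -> \bar R}) : closed (msupport nu).
Proof.
rewrite -openC openE => a /existsNP[U /not_implyP[oU /not_implyP[Ua nU]]].
by apply: (filterS _ (open_nbhs_nbhs (conj oU Ua))) => b Ub /(_ U oU Ub).
Qed.

Lemma measurable_msupport {R : realType} {d : nat}
    (nu : {measure set (euclid R d) -> \bar R}) : measurable (msupport nu).
Proof.
rewrite -[msupport nu]setCK; apply: measurableC; apply: open_euclid_measurable.
by rewrite openC; exact: closed_msupport.
Qed.

Lemma measurable_aeEqMfun {d1 d2} {R : realType} {T1 : measurableType d1}
    {T2 : measurableType d2} (mu : {measure set T1 -> \bar R})
    (f : {mfun_ mu, T1 >-> T2}) : measurable_fun [set: T1] f.
Proof. exact: (measurable_funPT (repr f)). Qed.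

(** The section is the composite of [f] with [z |-> (a, z)], which maps into [A * T2]. Measurability
    of [A] makes this rectangle measurable. *)
Lemma measurable_fun_section {d1 d2 d3} {T1 : measurableType d1}
    {T2 : measurableType d2} {T3 : measurableType d3}
    (A : set T1) (f : T1 -> T2 -> T3) (a : T1) :
  measurable A -> measurable_fun (A `*` [set: T2]) (fun x => f x.1 x.2) ->
  A a -> measurable_fun [set: T2] (f a).
Proof.
move=> mA mf Aa; apply: (measurable_comp _ _ mf (pair1_measurable a)).
- exact: measurableX.
- by move=> _ [z _ <-].
Qed.

Lemma cvg_integral_dominated_near {R : realType} {V : pseudoMetricType R}
    {d} {T : measurableType d} (mu : {measure set T -> \bar R})
    (s : T -> R) (f : V -> T -> R) (G : set V) (a : V) :
  nbhs a G -> measurable_fun setT s ->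
  (forall b, G b -> measurable_fun setT (f b)) ->
  (forall b z, G b -> 0 <= f b z) ->
  {ae mu, forall z, {for a, continuous (f ^~ z)}} ->
  (\int[mu]_z (`|s z|%:E * ereal_sup [set (f b z)%:E | b in G]) < +oo)%E ->
  fine (\int[mu]_z (s z * f b z)%:E) @[b --> a] -->
    fine (\int[mu]_z (s z * f a z)%:E).
Proof.
move=> aG ms mf f0 fa dom; apply: (@seq_cvg_at R V R^o _ _ _ G aG) => u Gu ua.
(* [esups _ 0%N] is the supremum of the tail from index 0, hence of the whole sequence. *)
pose h (z : T) := (`|s z|%:E * esups (fun n => (f (u n) z)%:E) 0%N)%E.
have fh n (z : T) : ((f (u n) z)%:E <= esups (fun n => (f (u n) z)%:E) 0%N)%E.
  by apply: ereal_sup_ubound; exists n.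
have h0 z : (0 <= h z)%E.
  rewrite /h mule_ge0// ?lee_fin//.
  by apply: le_trans (fh 0%N z); rewrite lee_fin f0.
have mh : measurable_fun setT h.
  apply: emeasurable_funM.
    by apply/measurable_EFinP; exact: measurableT_comp.
  by apply: measurable_fun_esups => n; apply/measurable_EFinP; exact: mf.
have ih : mu.-integrable setT h.
  apply/integrableP; split => //.
  under eq_integral do rewrite gee0_abs//.
  (* Every [u n] lies in [G], so [h] is below the integrand of [dom], which may be nonmeasurable. *)
  apply: le_lt_trans dom; apply: ge0_integral_mono => // z.
  rewrite lee_wpmul2l// ?lee_fin//.
  apply: ge_ereal_sup => _ [n _ <-]; apply: ereal_sup_ubound.
  by exists (u n).
have Ga := nbhs_singleton aG.
have [] := @dominated_convergence _ _ _ mu setT measurableT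
  (fun n z => (s z * f (u n) z)%:E) (fun z => (s z * f a z)%:E) h.
- by move=> n; apply/measurable_EFinP; apply: measurable_funM => //; exact: mf.
- by apply/measurable_EFinP; apply: measurable_funM => //; exact: mf.
- apply: filterS fa => z fz _; apply: cvg_EFin; first exact: nearW.
  by exact: cvgMl_tmp (cvg_comp _ _ ua fz).
- exact: ih.
- apply: nearW => z n _; rewrite /= normrM EFinM lee_wpmul2l//.
  by rewrite ger0_norm ?f0// fh.
(* The limit function is integrable, so [fine] does not alter its integral. *)
move=> ifa _ cv; apply: fine_cvg; rewrite fineK//.
exact: integrable_fin_num.
Qed.

Theorem lemma3p2 (R : realType) (d : nat)
    (dO : measure_display) (Omega : measurableType dO) (Pr : probability Omega R)
    (dZ : measure_display) (ZT : measurableType dZ)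
    (Z : {RV Pr >-> ZT}) (alpha : {RV Pr >-> euclid R d})
    (A : set (euclid R d)) (mu : {sigma_finite_measure set ZT -> \bar R})
    (f : euclid R d -> ZT -> R)
    (eta0 : probability (euclid R d) R) (P : probability ZT R)
    (model : uh_model Z alpha A mu f eta0 P)
    (N : set (euclid R d)) (NA : N `<=` A) (oN : open N)
    (r : LspaceType2 eta0)
    (r_moment : exists s : LspaceType2 P, L2_0 s /\ moment_eq mu f r s)
    (f_continuous : {ae mu, forall z, {in N, continuous (fun a => f a z)}})
    (f_dominated : forall a, N a ->
      exists Gamma0 : set (euclid R d),
        [/\ nbhs a Gamma0, Gamma0 `<=` N &
          forall s : LspaceType2 P, L2_0 s -> moment_eq mu f r s ->
            (\int[mu]_z (`|s z|%:E * ereal_sup [set (f b z)%:E | b in Gamma0])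
              < +oo)%E]) :
  L2_continuous_on N r.
Proof.
have [s [s0 rs]] := r_moment.
have mA : measurable A by rewrite (uh_support model); exact: measurable_msupport.
have mf b : A b -> measurable_fun setT (f b).
  exact: measurable_fun_section mA (uh_f_measurable model).
pose g a := if a \in N then phi r + fine (\int[mu]_z (s z * f a z)%:E) else r a.
(* Since [N] is open, a limit at a point of [N] does not see the values [r a] taken off [N]. *)
have gN a : N a -> {near nbhs a,
    (fun b => phi r + fine (\int[mu]_z (s z * f b z)%:E)) =1 g}.
  move=> Na; have := open_nbhs_nbhs (conj oN Na); apply: filterS => b Nb.
  by rewrite /g mem_set.
have cg : {in N, continuous g}.
  move=> a /set_mem Na; have [G [aG GN dom]] := f_dominated a Na.
  have /near_eq_cvg gE := gN a Na.
  rewrite /continuous_at [g a]/g mem_set//; apply: (cvg_trans gE).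
  apply: cvgD; first exact: cvg_cst.
  apply: (cvg_integral_dominated_near _ _ _ G) => //.
  - exact: (measurable_aeEqMfun _ s).
  - by move=> b Gb; apply: mf; exact/NA/GN.
  - by move=> b z Gb; apply: (uh_f_ge0 model); exact/NA/GN.
  - by apply: filterS f_continuous => z; apply; exact: mem_set.
  - exact: dom.
have mg : measurable_fun setT g.
  have mN := open_euclid_measurable _ oN.
  (* Measurability is glued from two pieces: continuity on the open set [N], and the representative
     of [r] on its complement. *)
  rewrite -(setUv N); apply/measurable_funU => //; first exact: measurableC.
  split; first exact: euclid_continuous_measurable.
  apply: (eq_measurable_fun r).
    by move=> a; rewrite inE /g => /= Na; rewrite memNset.
  by apply: measurable_funTS; exact: (measurable_aeEqMfun _ r).
exists (mfun_Sub (mem_set mg : g \in mfun)); split; last exact: cg.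
(* Where the moment equation holds, the integral is the real number [r a - phi r], so [fine] is
   exact and adding [phi r] gives back [r a]. *)
apply: filterS rs => a ra _ /=; rewrite /g.
by case: ifPn => // /set_mem _; rewrite -ra /= addrC subrK.
Qed.
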